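(* Let $\mathcal A$ be a unital complex $C^*$-algebra, let $a\in\mathcal A$, and let $\mathcal B$ be a (complex linear) subspace of $\mathcal A$. Let $b_0\in\mathcal B$ be a best approximation to $a$ in $\mathcal B$, i.e. $\|a-b_0\|\le\|a-b\|$ for all $b\in\mathcal B$. For a state $\phi$ on $\mathcal A$, let $\mathcal L_\phi=\{c\in\mathcal A:\phi(c^*c)=0\}$, equip $\mathcal A/\mathcal L_\phi$ with the inner product $\langle a_1+\mathcal L_\phi\,|\,a_2+\mathcal L_\phi\rangle=\phi(a_1^*a_2)$, let $\mathcal B/\mathcal L_\phi=\{b+\mathcal L_\phi: b\in\mathcal B\}\subseteq \mathcal A/\mathcal L_\phi$, and define $$M_{a,\mathcal B}(\phi)=\sup\Big\{\phi\big((a-b_0)^*(a-b_0)\big)-\sum_{\alpha}\big|\phi\big((a-b_0)^*b_\alpha\big)\big|^2\Big\},$$ where the supremum is taken over all orthonormal bases $\{b_\alpha+\mathcal L_\phi\}$ (with $b_\alpha\in\mathcal B$) of $\mathcal B/\mathcal L_\phi$ in the inner product space $\mathcal A/\mathcal L_\phi$. Then $$\operatorname{dist}(a,\mathcal B)^2=\max\{M_{a,\mathcal B}(\phi):\phi\in S_{\mathcal A}\},$$ where $\operatorname{dist}(a,\mathcal B)=\inf\{\|a-b\|:b\in\mathcal B\}$ and $S_{\mathcal A}$ is the set of states on $\mathcal A$.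
   Context: A state on a unital complex $C^*$-algebra $\mathcal A$ with identity $1_{\mathcal A}$ is a linear functional $\phi$ on $\mathcal A$ with $\phi(1_{\mathcal A})=1$ and $\phi(c)\ge 0$ for every positive element $c\in\mathcal A$. $S_{\mathcal A}$ denotes the set of all states on $\mathcal A$. *)

(* Defs.v *)
From HB Require Import structures.
From mathcomp Require Import all_boot all_order all_algebra.
From mathcomp Require Import all_classical all_reals all_analysis.
From mathcomp Require Import complex.
Set Implicit Arguments. Unset Strict Implicit. Unset Printing Implicit Defensive.
Import Order.TTheory GRing.Theory Num.Theory.
Import numFieldNormedType.Exports.
Local Open Scope classical_set_scope.
Local Open Scope ring_scope.

Section Cstar.
Variable R : realType.
Local Notation C := (R[i]).

Record CstarAlg (V : completeNormedModType C) := {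
  cmul : V -> V -> V;
  cone : V;
  cstar : V -> V;
  cmulA : forall x y z, cmul x (cmul y z) = cmul (cmul x y) z;
  cmulDl : forall (k : C) x y z, cmul (k *: x + y) z = k *: cmul x z + cmul y z;
  cmulDr : forall (k : C) x y z, cmul z (k *: x + y) = k *: cmul z x + cmul z y;
  cmul1l : forall x, cmul cone x = x;
  cmul1r : forall x, cmul x cone = x;
  cone_neq0 : cone <> 0;
  cstar_antilinear : forall (k : C) x y,
      cstar (k *: x + y) = Num.conj k *: cstar x + cstar y;
  cstarK : forall x, cstar (cstar x) = x;
  cstarM : forall x y, cstar (cmul x y) = cmul (cstar y) (cstar x);
  cnormM : forall x y, `|cmul x y| <= `|x| * `|y|;
  cstar_identity : forall x, `|cmul (cstar x) x| = `|x| ^+ 2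
}.

Variables (V : completeNormedModType C) (A : CstarAlg V).

Definition cinvertible (x : V) : Prop :=
  exists y, cmul A x y = cone A /\ cmul A y x = cone A.

Definition cpositive (c : V) : Prop :=
  cstar A c = c /\
  forall lambda : C, ~ (0 <= lambda) -> cinvertible (c - lambda *: cone A).

Definition is_state (phi : V -> C) : Prop :=
  (forall (k : C) x y, phi (k *: x + y) = k * phi x + phi y) /\
  phi (cone A) = 1 /\
  (forall c, cpositive c -> 0 <= phi c).

Definition is_subspace (B : set V) : Prop :=
  B 0 /\ (forall (k : C) x y, B x -> B y -> B (k *: x + y)).

(** Semi-inner product <x|y>_phi = phi(x^* y) on A (inducing the inner
    product on A / L_phi). *)
Definition sip (phi : V -> C) (x y : V) : C := phi (cmul A (cstar A x) y).

(** [S] is a set of representatives (in B) of an orthonormal basis, i.e. a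
    maximal orthonormal family, of B / L_phi inside A / L_phi. *)
Definition onb_reps (phi : V -> C) (B : set V) (S : set V) : Prop :=
  S `<=` B /\
  (forall s, S s -> sip phi s s = 1) /\
  (forall s t, S s -> S t -> s <> t -> sip phi s t = 0) /\
  (forall b, B b -> sip phi b b = 1 -> ~ (forall s, S s -> sip phi s b = 0)).

Definition cabs2 (z : C) : R := complex.Re z ^+ 2 + complex.Im z ^+ 2.

Definition Mfun (a b0 : V) (B : set V) (phi : V -> C) : \bar R :=
  ereal_sup [set ((complex.Re (sip phi (a - b0) (a - b0)))%:E -
                  \esum_(s in S) (cabs2 (sip phi (a - b0) s))%:E)%E
            | S in onb_reps phi B].

Definition cdist (a : V) (B : set V) : R :=
  inf [set complex.Re `|a - b| | b in B].

End Cstar.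

(* Main.v *)
(* Write [x = a - b0] and [r = N x]. A state [phi] satisfies [phi (x^* x) <= r^2],
   because [r^2 - x^* x] is positive, so [M (phi) <= r^2]; equality holds as soon as
   [phi (x^* x) = r^2] and [phi (x^* b) = 0] for all [b] in [B].

   Such a state is a norm-one Hahn-Banach extension of
   [al + be x^* x + x^* b |-> al + be r^2]. This functional is contractive: if
   [g = al + be x^* x + x^* b] had norm less than [1 = al + be r^2], then with
   [D = r^2 - x x^*] and [e = be x + b],
   [x + s r^2 b = x ((1 - s) + s g) + D (s e)], and since [x x^* + D = r^2] the
   squared norm of the right-hand side is at most
   [r^2 (N ((1 - s) + s g)^2 + O (s^2))]; for small [s > 0] this is less than
   [r^2], against the minimality of [b0].

   The order theory of the algebra rests on square roots of [t - y] for
   [N y < t], obtained as fixed points of a contraction: they show that the norm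
   of a self-adjoint element is attained on its spectrum, without the spectral
   radius formula. *)
Require Import Defs.
From HB Require Import structures.
From mathcomp Require Import all_boot all_order all_algebra.
From mathcomp Require Import all_classical all_reals all_analysis.
From mathcomp Require Import complex ring lra.
Set Implicit Arguments. Unset Strict Implicit. Unset Printing Implicit Defensive.
Import Order.TTheory GRing.Theory Num.Theory.
Import numFieldNormedType.Exports.
Local Open Scope classical_set_scope.
Local Open Scope ring_scope.
Local Open Scope complex_scope.


(** * Real-valued modulus of complex numbers *)

Section ComplexModulus.
Variable R : rcfType.
Implicit Types (z : R[i]) (t : R).

Lemma Re_norm_ge0 z : 0 <= complex.Re `|z|.
Proof. by rewrite -ler0c RRe_real ?normr_real ?normr_ge0. Qed.

Lemma Re_norm_real t : complex.Re `|t%:C| = `|t|.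
Proof. by rewrite normc_def/= expr0n/= addr0 sqrtr_sqr. Qed.

Lemma Re_normV z : z != 0 -> complex.Re `|z^-1| * complex.Re `|z| = 1.
Proof.
move=> z0; have : `|z^-1| * `|z| = 1 by rewrite -normrM mulVf// normr1.
rewrite -(RRe_real (normr_real z)) -(RRe_real (normr_real z^-1)).
by rewrite -rmorphM/= => -[].
Qed.

Lemma sqr_Re_norm z :
  complex.Re `|z| ^+ 2 = complex.Re z ^+ 2 + complex.Im z ^+ 2.
Proof. by rewrite normc_def/= sqr_sqrtr ?addr_ge0 ?sqr_ge0. Qed.

Lemma Re_le_norm z : complex.Re z <= complex.Re `|z|.
Proof.
case: z => a b; rewrite normc_def/= (le_trans (ler_norm a))//.
by rewrite -sqrtr_sqr ler_wsqrtr// lerDl sqr_ge0.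
Qed.

Lemma complexi2 : 'i * 'i = -1 :> R[i]. Proof. by rewrite -expr2 sqr_i. Qed.

End ComplexModulus.

(** * Normalization of polynomials in noncommuting variables *)

Section NoncommutativeNormalization.
Variables (K : comNzRingType) (V : algType K).

Inductive nexpr :=
| NVar of nat | NZero | NOne
| NAdd of nexpr & nexpr | NOpp of nexpr | NMul of nexpr & nexpr
| NScale of K & nexpr.

Fixpoint neval (env : nat -> V) (e : nexpr) : V :=
  match e with
  | NVar n => env n
  | NZero => 0
  | NOne => 1
  | NAdd a b => neval env a + neval env b
  | NOpp a => - neval env a
  | NMul a b => neval env a * neval env b
  | NScale k a => k *: neval env a
  end.

(** [word_eqb] and [wapp] are local fixpoints so that [cbn] with an explicit list of names computes
    the normal form and leaves the scalars alone. *)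
Fixpoint word_eqb (s t : list nat) : bool :=
  match s, t with
  | [::], [::] => true
  | x :: s', y :: t' => if Nat.eqb x y then word_eqb s' t' else false
  | _, _ => false
  end.

Lemma word_eqbP s t : word_eqb s t -> s = t.
Proof.
elim: s t => [|x s IH] [|y t] //=; case E: (Nat.eqb x y) => // /IH ->.
by move/PeanoNat.Nat.eqb_eq: E => ->.
Qed.

Definition wprod (env : nat -> V) (w : list nat) : V :=
  foldr (fun i v => env i * v) 1 w.

Definition leval (env : nat -> V) (l : list (K * list nat)) : V :=
  foldr (fun p v => p.1 *: wprod env p.2 + v) 0 l.

Fixpoint linsert (k : K) (w : list nat) (l : list (K * list nat)) :=
  match l with
  | [::] => [:: (k, w)]
  | (k', w') :: l' =>
      if word_eqb w w' then (k + k', w') :: l' else (k', w') :: linsert k w l'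
  end.

Fixpoint ladd (l1 l2 : list (K * list nat)) :=
  match l1 with
  | [::] => l2
  | (k, w) :: l => linsert k w (ladd l l2)
  end.

Fixpoint lscale (c : K) (l : list (K * list nat)) :=
  match l with
  | [::] => [::]
  | (k, w) :: l' => (c * k, w) :: lscale c l'
  end.

Fixpoint wapp (s t : list nat) :=
  match s with [::] => t | x :: s' => x :: wapp s' t end.

Fixpoint lmul1 (c : K) (u : list nat) (l : list (K * list nat)) :=
  match l with
  | [::] => [::]
  | (k, w) :: l' => (c * k, wapp u w) :: lmul1 c u l'
  end.

Fixpoint lmul (l1 l2 : list (K * list nat)) :=
  match l1 with
  | [::] => [::]
  | (k, w) :: l => ladd (lmul1 k w l2) (lmul l l2)
  end.

Fixpoint nnorm (e : nexpr) : list (K * list nat) :=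
  match e with
  | NVar n => [:: (1, [:: n])]
  | NZero => [::]
  | NOne => [:: (1, [::])]
  | NAdd a b => ladd (nnorm a) (nnorm b)
  | NOpp a => lscale (-1) (nnorm a)
  | NMul a b => lmul (nnorm a) (nnorm b)
  | NScale k a => lscale k (nnorm a)
  end.

Lemma leval_insert env k w l :
  leval env (linsert k w l) = k *: wprod env w + leval env l.
Proof.
elim: l => [|[k' w'] l IH] //=; case: ifP => [/word_eqbP ->|_] /=.
  by rewrite scalerDl addrA.
by rewrite IH addrCA.
Qed.

Lemma leval_add env l1 l2 : leval env (ladd l1 l2) = leval env l1 + leval env l2.
Proof.
by elim: l1 => [|[k w] l IH] /=; rewrite ?add0r// leval_insert IH addrA.
Qed.

Lemma leval_scale env c l : leval env (lscale c l) = c *: leval env l.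
Proof.
by elim: l => [|[k w] l IH] /=; rewrite ?scaler0// IH scalerDr scalerA.
Qed.

Lemma wprod_app env s t : wprod env (wapp s t) = wprod env s * wprod env t.
Proof. by elim: s => [|x s IH] /=; rewrite ?mul1r// IH mulrA. Qed.

Lemma leval_mul1 env c u l :
  leval env (lmul1 c u l) = (c *: wprod env u) * leval env l.
Proof.
elim: l => [|[k w] l IH] /=; first by rewrite mulr0.
by rewrite IH mulrDr wprod_app; congr (_ + _); rewrite -scalerAl -scalerAr scalerA.
Qed.

Lemma leval_mul env l1 l2 : leval env (lmul l1 l2) = leval env l1 * leval env l2.
Proof.
elim: l1 => [|[k w] l IH] /=; first by rewrite mul0r.
by rewrite leval_add leval_mul1 IH mulrDl.
Qed.

Lemma leval_norm env e : leval env (nnorm e) = neval env e.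
Proof.
elim: e => [n|||a IHa b IHb|a IHa|a IHa b IHb|k a IHa] /=.
- by rewrite scale1r addr0 mulr1.
- by [].
- by rewrite scale1r addr0.
- by rewrite leval_add IHa IHb.
- by rewrite leval_scale IHa scaleN1r.
- by rewrite leval_mul IHa IHb.
- by rewrite leval_scale IHa.
Qed.

(** Normalization merges like monomials but keeps vanishing coefficients. Each becomes a scalar
    equation [k = 0] for [ring] or [field], possibly modulo ['i * 'i = -1]. *)
Fixpoint lzero (l : list (K * list nat)) : Prop :=
  match l with
  | [::] => True
  | (k, _) :: l' => k = 0 /\ lzero l'
  end.

Lemma neval_eq env e1 e2 :
  lzero (nnorm (NAdd e1 (NOpp e2))) -> neval env e1 = neval env e2.
Proof.
move=> H; apply/eqP; rewrite -subr_eq0; apply/eqP.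
rewrite -[LHS]/(neval env (NAdd e1 (NOpp e2))) -leval_norm.
by elim: (nnorm _) H => [|[k w] l IH] //= [-> /IH ->]; rewrite scale0r addr0.
Qed.

End NoncommutativeNormalization.

Ltac nfind x env :=
  lazymatch env with
  | cons x ?e => constr:(0%N)
  | cons _ ?e => let n := nfind x e in constr:(S n)
  end.

Ltac nmem x env :=
  lazymatch env with
  | nil => constr:(false)
  | cons x _ => constr:(true)
  | cons _ ?e => nmem x e
  end.

(** Anything other than an algebra operation, such as [star x], is an atom, so [star] has to be
    pushed inward before normalization. *)
Ltac ncollect env t :=
  lazymatch t with
  | 0 => env
  | 1 => env
  | ?a + ?b => let env := ncollect env a in ncollect env b
  | - ?a => ncollect env a
  | ?a * ?b => let env := ncollect env a in ncollect env b
  | ?k *: ?a => ncollect env a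
  | ?x => lazymatch nmem x env with true => env | false => constr:(cons x env) end
  end.

Ltac nreify K env t :=
  lazymatch t with
  | 0 => constr:(@NZero K)
  | 1 => constr:(@NOne K)
  | ?a + ?b => let a := nreify K env a in let b := nreify K env b in
               constr:(@NAdd K a b)
  | - ?a => let a := nreify K env a in constr:(@NOpp K a)
  | ?a * ?b => let a := nreify K env a in let b := nreify K env b in
               constr:(@NMul K a b)
  | ?k *: ?a => let a := nreify K env a in constr:(@NScale K k a)
  | ?x => let n := nfind x env in constr:(@NVar K n)
  end.

(* Equality in an algebra, reduced to the equality of the scalar coefficients
   of each noncommutative monomial. *)
Ltac nalg_in K V :=
  lazymatch goal with |- @eq ?T ?l ?r =>
    let env := ncollect (@nil T) l in
    let env := ncollect env r in
    let e1 := nreify K env l in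
    let e2 := nreify K env r in
    refine (@neval_eq K V (fun i => nth 0 env i) e1 e2 _);
    cbn [nnorm ladd lmul lmul1 lscale linsert word_eqb wapp Nat.eqb lzero];
    repeat split
  end.

(* An alias of [V] indexed by [A], to carry the multiplication of [A] as a
   canonical algebra structure. *)
Definition calg (R : realType) (V : completeNormedModType R[i])
  (A : CstarAlg V) : Type := V.

(** * Algebra structure carried by the product of [A] *)

Section CstarRing.
Variables (R : realType) (V : completeNormedModType R[i]) (A : CstarAlg V).
Local Notation C := R[i].
Local Notation calg := (calg A).

HB.instance Definition _ := GRing.Lmodule.copy calg V.

Let cmul' : calg -> calg -> calg := cmul A.
Let cone' : calg := cone A.

Fact calg_mulA : associative cmul'. Proof. exact: cmulA. Qed.
Fact calg_mul1l : left_id cone' cmul'. Proof. exact: cmul1l. Qed.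
Fact calg_mul1r : right_id cone' cmul'. Proof. exact: cmul1r. Qed.
Fact calg_mulDl : left_distributive cmul' +%R.
Proof.
by move=> x y z; have := cmulDl A 1 x y z; rewrite !scale1r.
Qed.
Fact calg_mulDr : right_distributive cmul' +%R.
Proof.
by move=> x y z; have := cmulDr A 1 y z x; rewrite !scale1r.
Qed.
Fact calg_1neq0 : cone' != 0.
Proof. apply/eqP; exact: cone_neq0. Qed.

HB.instance Definition _ := GRing.Zmodule_isNzRing.Build calg
  calg_mulA calg_mul1l calg_mul1r calg_mulDl calg_mulDr calg_1neq0.

Fact calg_scaleAl (k : C) (x y : calg) : k *: (x * y) = (k *: x) * y.
Proof.
have E z : cmul A 0 z = 0.
  have := cmulDl A 1 0 0 z; rewrite !scale1r addr0 => /esym/eqP.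
  by rewrite -subr_eq0 addrK => /eqP.
by have := cmulDl A k x 0 y; rewrite E !addr0.
Qed.

HB.instance Definition _ := GRing.Lmodule_isLalgebra.Build C calg calg_scaleAl.

Fact calg_scaleAr (k : C) (x y : calg) : k *: (x * y) = x * (k *: y).
Proof.
have E z : cmul A z 0 = 0.
  have := cmulDr A 1 0 0 z; rewrite !scale1r addr0 => /esym/eqP.
  by rewrite -subr_eq0 addrK => /eqP.
by have := cmulDr A k y 0 x; rewrite E !addr0.
Qed.

HB.instance Definition _ := GRing.Lalgebra_isAlgebra.Build C calg calg_scaleAr.

End CstarRing.

Tactic Notation "nalg" constr(A) :=
  lazymatch type of A with @CstarAlg ?R _ =>
    let K := constr:(R[i] : comNzRingType) in
    let W := constr:(calg A : algType R[i]) in nalg_in K W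
  end.

(** * Norm, involution and completeness *)

Section CstarNorm.
Variables (R : realType) (V : completeNormedModType R[i]) (A : CstarAlg V).
Local Notation C := R[i].
Implicit Types (x y z h : calg A) (s t : R).

(** The norm of [V] has values in [R[i]]; they are real, so the real part loses nothing and allows
    real arithmetic. *)
Definition cnorm (x : calg A) : R := complex.Re `|x : V|.
Definition star (x : calg A) : calg A := cstar A x.
Local Notation N := cnorm.

Lemma cnormE x : `|x : V| = (N x)%:C.
Proof. by rewrite /cnorm RRe_real// normr_real. Qed.

Lemma cnorm_ge0 x : 0 <= N x.
Proof. by rewrite -ler0c -cnormE normr_ge0. Qed.

Lemma cnorm0 : N 0 = 0.
Proof. by apply: complexI; rewrite -cnormE normr0. Qed.

Lemma cnorm_eq0 x : N x = 0 -> x = 0.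
Proof. by move=> H; apply: (@normr0_eq0 _ V); rewrite cnormE H. Qed.

Lemma cnormD x y : N (x + y) <= N x + N y.
Proof. by rewrite -lecR rmorphD/= -!cnormE; exact: (@ler_normD _ V). Qed.

Lemma cnormZ (k : C) x : N (k *: x) = complex.Re `|k| * N x.
Proof.
by rewrite /cnorm (@normrZ _ V) (cnormE x) -(RRe_real (normr_real k)); simpc.
Qed.

Lemma cnormZr t x : N (t%:C *: x) = `|t| * N x.
Proof. by rewrite cnormZ Re_norm_real. Qed.

Lemma cnormN x : N (- x) = N x.
Proof. by apply: complexI; rewrite -!cnormE; exact: (@normrN _ V). Qed.

Lemma cnormB x y : N (x - y) <= N x + N y.
Proof. by rewrite -(cnormN y); exact: cnormD. Qed.

Lemma cnormM_le x y : N (x * y) <= N x * N y.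
Proof. by rewrite -lecR rmorphM/= -!cnormE; exact: (cnormM A). Qed.

Lemma cnorm_starM x : N (star x * x) = N x ^+ 2.
Proof.
by apply: complexI; rewrite rmorphXn/= -!cnormE; exact: (cstar_identity A).
Qed.

Lemma starK x : star (star x) = x. Proof. exact: cstarK. Qed.

Lemma starM x y : star (x * y) = star y * star x.
Proof. exact: cstarM. Qed.

Lemma starD x y : star (x + y) = star x + star y.
Proof.
by have := cstar_antilinear A 1 x y; rewrite rmorph1 !scale1r.
Qed.

Lemma star0 : star 0 = 0.
Proof. by have /esym/eqP := starD 0 0; rewrite addr0 -subr_eq0 addrK => /eqP. Qed.

Lemma starZ (k : C) x : star (k *: x) = (k^*)%C *: star x.
Proof.
by have := cstar_antilinear A k x 0; rewrite !addr0 -/(star 0) star0 addr0.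
Qed.

Lemma starZr t x : star (t%:C *: x) = t%:C *: star x.
Proof. by rewrite starZ conjc_real. Qed.

Lemma starZi x : star ('i *: x) = - ('i *: star x).
Proof. by rewrite starZ /= -scaleNr; congr (_ *: _); simpc. Qed.

Lemma starN x : star (- x) = - star x.
Proof. by apply/eqP; rewrite -addr_eq0 -starD addNr star0. Qed.

Lemma starB x y : star (x - y) = star x - star y.
Proof. by rewrite starD starN. Qed.

Lemma star1 : star 1 = 1.
Proof. by rewrite -[LHS]mul1r -{1}(starK 1) -starM mul1r starK. Qed.

Definition starE := (starD, starB, starN, starZr, starZi, starM, starK, star1, star0).

Lemma cnorm1 : N 1 = 1.
Proof.
have H := cnorm_starM 1; rewrite star1 mulr1 in H.
have /eqP : N 1 * (N 1 - 1) = 0 by rewrite mulrBr mulr1 -expr2 -H subrr.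
rewrite mulf_eq0 => /orP[/eqP/cnorm_eq0/eqP|/eqP/subr0_eq//].
by rewrite oner_eq0.
Qed.

(** Cancelling [N y] in [N y ^+ 2 = N (star y * y) <= N (star y) * N y] gives one inequality;
    exchanging [y] and [star y] gives the other. *)
Lemma cnorm_star x : N (star x) = N x.
Proof.
suff H y : N y <= N (star y) by apply/eqP; rewrite eq_le -{2}(starK x) !H.
have := cnorm_ge0 (star y); rewrite le_eqVlt => /orP[/eqP/esym H|H].
  by rewrite (_ : y = 0) ?cnorm0 ?cnorm_ge0// -(starK y) (cnorm_eq0 H) star0.
have [->|y0] := eqVneq (N y) 0; first by rewrite ltW.
have y1 : 0 < N y by rewrite lt_def y0 cnorm_ge0.
by rewrite -(ler_pM2r y1) -expr2 -cnorm_starM cnormM_le.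
Qed.

Lemma cnorm_sqr h : star h = h -> N (h * h) = N h ^+ 2.
Proof. by move=> H; rewrite -{1}H cnorm_starM. Qed.

Lemma cnorm_complete (u : nat -> calg A) :
  (forall e : R, 0 < e ->
    exists n0, forall n m, (n0 <= n)%N -> (n0 <= m)%N -> N (u n - u m) < e) ->
  exists l : calg A, forall e : R, 0 < e ->
    exists n0, forall n, (n0 <= n)%N -> N (u n - l) < e.
Proof.
move=> uC; pose v : nat -> V := u.
have cv : cvg (v @ \oo).
  apply/cauchy_cvgP; apply/cauchy_ballP => e e0.
  have e0' : 0 < complex.Re e by move: e0; rewrite ltcE => /andP[].
  have eE : e = (complex.Re e)%:C by rewrite RRe_real// gtr0_real.
  have [n0 Hn0] := uC _ e0'.
  exists (v @` [set n | (n0 <= n)%N], v @` [set n | (n0 <= n)%N]) => /=.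
    by split; exists n0 => // n Hn; exists n.
  move=> [_ _] [/= [n Hn <-] [m Hm <-]]; rewrite -ball_normE/= eE.
  by rewrite (cnormE (u n - u m)) ltcR; exact: Hn0.
exists (lim (v @ \oo)) => e e0.
have e0' : 0 < e%:C by rewrite ltcR.
have /cvgrPdist_lt/(_ _ e0')[n0 _ Hn0] := cv.
exists n0 => n Hn; have := Hn0 n Hn.
by rewrite /= -cnormN opprB (cnormE (lim (v @ \oo) - u n)) ltcR.
Qed.

(** Banach's fixed point theorem on a subset [P] closed under limits. The fixed point inherits what
    [P] records: in [csqrt1], self-adjointness, commutation and a norm bound. *)
Lemma cnorm_fixpoint (P : calg A -> Prop) (f : calg A -> calg A) (q : R) x0 :
  0 <= q -> q < 1 -> P x0 -> (forall x, P x -> P (f x)) ->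
  (forall x y, P x -> P y -> N (f x - f y) <= q * N (x - y)) ->
  (forall x, (forall e : R, 0 < e -> exists2 y, P y & N (x - y) < e) -> P x) ->
  exists2 x, P x & f x = x.
Proof.
move=> q0 q1 P0 Pf fq clP; pose u n := iter n f x0.
have Pu n : P (u n) by elim: n => //= n; exact: Pf.
have step n : N (u n.+1 - u n) <= q ^+ n * N (u 1%N - x0).
  elim: n => [|n IH]; first by rewrite expr0 mul1r.
  rewrite exprS -mulrA (le_trans (fq _ _ (Pu n.+1) (Pu n)))//.
  exact: ler_wpM2l.
pose M := N (u 1%N - x0) / (1 - q).
have q1' : 0 < 1 - q by rewrite subr_gt0.
have dist n m : N (u (n + m)%N - u n) <= M * q ^+ n.
  (* This telescoping bound makes the induction on [m] close; [M * q ^+ n] alone would not. *)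
  suff H : N (u (n + m)%N - u n) <= M * (q ^+ n - q ^+ (n + m)).
    apply: (le_trans H); rewrite mulrBr lerBlDr lerDl.
    by rewrite mulr_ge0 ?exprn_ge0// divr_ge0 ?cnorm_ge0// ltW.
  elim: m => [|m IH]; first by rewrite addn0 !subrr cnorm0 mulr0.
  rewrite addnS -(subrKA (u (n + m)%N)) (le_trans (cnormD _ _))//.
  apply: (le_trans (lerD (step _) IH)).
  rewrite exprS /M le_eqVlt; apply/orP; left; apply/eqP; field.
  by rewrite gt_eqF.
have M0 : 0 <= M by rewrite divr_ge0 ?cnorm_ge0// ltW.
have small (e : R) : 0 < e -> exists n0, M * q ^+ n0 < e.
  move=> e0; have : (fun n => q ^+ n) @ \oo --> (0 : R).
    by apply: cvg_expr; rewrite ger0_norm.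
  have e1 : 0 < e / (M + 1) by rewrite divr_gt0// ltr_wpDl.
  move=> /cvgrPdist_lt/(_ _ e1)[n0 _ /(_ n0 (leqnn _))]/=.
  rewrite sub0r normrN ger0_norm ?exprn_ge0// => H; exists n0.
  rewrite ltr_pdivlMr ?ltr_wpDl// in H; rewrite (le_lt_trans _ H)// mulrC.
  by rewrite ler_wpM2l ?exprn_ge0// lerDl.
have [|l Hl] := @cnorm_complete u.
  move=> e e0; have e2 : 0 < e / 2 by rewrite divr_gt0.
  have [n0 Hn0] := small _ e2; exists n0 => n m Hn Hm.
  have D k : (n0 <= k)%N -> N (u k - u n0) < e / 2.
    by move=> Hk; rewrite -(subnKC Hk) (le_lt_trans (dist _ _)).
  rewrite -(subrKA (u n0)) (le_lt_trans (cnormD _ _))//.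
  by rewrite -(cnormN (u n0 - u m)) opprB (splitr e) ltrD// D.
have Pl : P l.
  apply: clP => e e0; have [n0 Hn0] := Hl e e0.
  by exists (u n0) => //; rewrite -cnormN opprB Hn0.
exists l => //; apply/subr0_eq/cnorm_eq0/eqP; rewrite eq_le cnorm_ge0 andbT.
rewrite leNgt; apply/negP => F0.
have F2 : 0 < N (f l - l) / 2 by rewrite divr_gt0.
have [n0 Hn0] := Hl _ F2; have Ha := Hn0 n0 (leqnn _).
have Hb := Hn0 n0.+1 (leqnSn _).
have Hc : N (f l - u n0.+1) <= N (u n0 - l).
  rewrite -(cnormN (u n0 - l)) opprB (le_trans (fq _ _ Pl (Pu n0)))//.
  by rewrite ler_piMl ?cnorm_ge0 ?ltW.
have := cnormD (f l - u n0.+1) (u n0.+1 - l); rewrite subrKA; lra.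
Qed.

End CstarNorm.

(** * Inverses and square roots as fixed points *)

Section CstarInverse.
Variables (R : realType) (V : completeNormedModType R[i]) (A : CstarAlg V).
Local Notation C := R[i].
Local Notation N := (@cnorm R V A).
Local Notation star := (@star R V A).
Local Notation r1 t := (t%:C *: (1 : calg A)).
Implicit Types (x y z h : calg A) (s t : R).

Definition cinv x : Prop := exists y, x * y = 1 /\ y * x = 1.

Lemma cinvM x y : cinv x -> cinv y -> cinv (x * y).
Proof.
move=> [a [xa ax]] [b [yb by_]]; exists (b * a); split.
  by rewrite -mulrA (mulrA y) yb mul1r.
by rewrite -mulrA (mulrA a) ax mul1r.
Qed.

Lemma cinvZ (k : C) x : k != 0 -> cinv x -> cinv (k *: x).
Proof.
move=> k0 [a [xa ax]]; exists (k^-1 *: a).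
rewrite -!scalerAl -!scalerAr !scalerA xa ax mulfV// mulVf//.
by rewrite scale1r.
Qed.

Lemma cinvN x : cinv x -> cinv (- x).
Proof.
by move=> H; rewrite -scaleN1r; apply: cinvZ; rewrite // oppr_eq0 oner_eq0.
Qed.

Lemma cinv_comm x g c : x * g = 1 -> g * x = 1 -> c * x = x * c -> c * g = g * c.
Proof.
move=> xg gx cx.
by rewrite -[c * g]mul1r -gx -(mulrA g) (mulrA x) -cx -(mulrA c) xg mulr1.
Qed.

Lemma star_inv x g : star x = x -> x * g = 1 -> g * x = 1 -> star g = g.
Proof.
move=> sx xg gx; rewrite -[star g]mulr1 -xg mulrA -{1}sx -starM xg star1.
by rewrite mul1r.
Qed.

(** A right inverse comes from the fixed point of [p |-> 1 + y p], a left inverse from that of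
    [p |-> 1 + p y]; the two agree by associativity. *)
Lemma neumann y : N y < 1 ->
  exists g, [/\ (1 - y) * g = 1, g * (1 - y) = 1 & N g * (1 - N y) <= 1].
Proof.
move=> y1.
have [||||p _ fp] := @cnorm_fixpoint R V A (fun=> True)
    (fun p => 1 + y * p) (N y) 0 (cnorm_ge0 y) y1 => //.
  by move=> a b _ _; rewrite opprD addrACA subrr add0r -mulrBr cnormM_le.
have [||||q _ fq] := @cnorm_fixpoint R V A (fun=> True)
    (fun p => 1 + p * y) (N y) 0 (cnorm_ge0 y) y1 => //.
  by move=> a b _ _; rewrite opprD addrACA subrr add0r -mulrBl mulrC cnormM_le.
have yp : (1 - y) * p = 1 by rewrite mulrBl mul1r -{1}fp addrK.
have qy : q * (1 - y) = 1 by rewrite mulrBr mulr1 -{1}fq addrK.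
have qp : q = p by rewrite -[q]mulr1 -yp mulrA qy mul1r.
exists p; split => //; first by rewrite -qp.
have := cnormD 1 (y * p); rewrite fp cnorm1 => H.
have := cnormM_le y p; lra.
Qed.

Lemma cinv_subl (k : C) y : N y < complex.Re `|k| -> cinv (k *: 1 - y).
Proof.
move=> yk.
have k0 : k != 0.
  by apply: contraTneq yk => ->; rewrite normr0 -leNgt cnorm_ge0.
have kE := Re_normV k0.
have kp : 0 < complex.Re `|k| by exact: le_lt_trans (cnorm_ge0 _) yk.
have [|g [g1 g2 _]] := @neumann (k^-1 *: y).
  by rewrite cnormZ -kE ltr_pM2l// -(pmulr_lgt0 _ kp) kE.
rewrite (_ : _ - y = k *: (1 - k^-1 *: y)).
  by apply: cinvZ => //; exists g.
by rewrite scalerBr scalerA mulfV// scale1r.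
Qed.

Lemma cinv_sublr t y : N y < t -> cinv (r1 t - y).
Proof.
move=> yt; apply: cinv_subl; rewrite Re_norm_real.
by rewrite ger0_norm// ltW// (le_lt_trans (cnorm_ge0 y)).
Qed.

(** Factor [x - y = x (1 - g y)] and invert the second factor. Contraposed: the inverse of an
    element close to a singular one is large. *)
Lemma cinv_perturb x g y : x * g = 1 -> g * x = 1 -> N g * N y < 1 ->
  exists g', [/\ (x - y) * g' = 1, g' * (x - y) = 1
               & N g' * (1 - N g * N y) <= N g].
Proof.
move=> xg gx gy.
have gy1 := cnormM_le g y.
have [|k [k1 k2 Nk]] := @neumann (g * y); first exact: le_lt_trans gy.
have E : x - y = x * (1 - g * y) by rewrite mulrBr mulr1 mulrA xg mul1r.
exists (k * g); rewrite E; split.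
- by rewrite -mulrA (mulrA _ k) k1 mul1r.
- by rewrite -mulrA (mulrA g) gx mul1r.
have := cnormM_le k g; have := cnorm_ge0 g; have := cnorm_ge0 k.
move: (N k) (N g) (N y) (N (g * y)) (N (k * g)) Nk gy1 gy => a b c d e.
move=> H1 H2 H3 H4 H5 H6.
have H7 : a * (1 - b * c) <= 1.
  by apply: le_trans H1; apply: ler_wpM2l => //; lra.
have H8 : 0 <= 1 - b * c by lra.
apply: (le_trans (ler_wpM2r H8 H6)).
by rewrite mulrAC ler_piMl.
Qed.

(** Membership of [z] in the bicommutant of [y]. It replaces the functional calculus wherever
    elements built from [y] have to commute. *)
Definition bicomm y z : Prop := forall x, x * y = y * x -> x * z = z * x.

Lemma le_approx (a b k : R) :
  0 <= k -> (forall e, 0 < e -> a <= b + k * e) -> a <= b.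
Proof.
move=> k0 H; rewrite leNgt; apply/negP => ba.
have k1 : 0 < k + 1 by lra.
have e0 : 0 < (a - b) / 2 / (k + 1) by rewrite !divr_gt0// subr_gt0.
have := H _ e0; have : k * ((a - b) / 2 / (k + 1)) <= (a - b) / 2.
  rewrite mulrCA ler_piMr ?divr_ge0 ?subr_ge0 ?(ltW ba)//.
  by rewrite ler_pdivrMr// mul1r lerDl.
lra.
Qed.

Lemma cnorm_approx_eq x y k : 0 <= k -> (forall e, 0 < e -> N (x - y) <= k * e) ->
  x = y.
Proof.
move=> k0 H; apply/subr0_eq/cnorm_eq0/eqP; rewrite eq_le cnorm_ge0 andbT.
by apply: (@le_approx _ _ k) => // e e0; rewrite add0r H.
Qed.

(* The square root of [1 - y] is [1 - w] for the fixed point [w] of the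
   contraction [w |-> (y + w^2) / 2] of the ball of radius [1 - sqrt (1 - N y)]. *)
Lemma csqrt1 y : star y = y -> N y < 1 ->
  exists z, [/\ star z = z, bicomm y z & z * z = 1 - y].
Proof.
move=> sy y1; pose n := N y; pose a := Num.sqrt (1 - n); pose s := 1 - a.
have n0 : 0 <= n := cnorm_ge0 y.
have a2 : a * a = 1 - n by rewrite -expr2 sqr_sqrtr// subr_ge0 ltW.
have a0 : 0 < a by rewrite sqrtr_gt0 subr_gt0.
have a1 : a <= 1 by nra.
have s0 : 0 <= s by rewrite /s; lra.
have s1 : s < 1 by rewrite /s; lra.
(* As a root of [s^2 - 2 s + n], the radius [s] makes the ball stable under [f]; it is also the
   contraction constant. *)
have sE : (n + s * s) / 2 = s by rewrite /s; lra.
pose P w := [/\ star w = w, bicomm y w & N w <= s].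
pose f w : calg A := (2^-1 : R)%:C *: (y + w * w).
have Nhalf w : N ((2^-1 : R)%:C *: w) = N w / 2.
  by rewrite cnormZr ger0_norm ?invr_ge0// mulrC.
have [||||w [sw cw _] fw] := @cnorm_fixpoint R V A P f s 0 s0 s1.
- split; rewrite ?star0 ?cnorm0// => x _; by rewrite mulr0 mul0r.
- move=> w [sw cw Nw]; split.
  + by rewrite /f !starE sw sy.
  + move=> x xy; rewrite /f -scalerAr -scalerAl mulrDr mulrDl xy.
    by rewrite mulrA (cw x xy) -mulrA (cw x xy) mulrA.
  + rewrite /f Nhalf -sE ler_pM2r ?invr_gt0//.
    apply: (le_trans (cnormD _ _)); rewrite lerD2l.
    apply: (le_trans (cnormM_le _ _)).
    by apply: ler_pM => //; exact: cnorm_ge0.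
- move=> u v [_ _ Nu] [_ _ Nv].
  have -> : f u - f v = (2^-1 : R)%:C *: (u * (u - v) + (u - v) * v).
    by rewrite /f; nalg A; ring.
  rewrite Nhalf ler_pdivrMr//; apply: (le_trans (cnormD _ _)).
  have := cnormM_le u (u - v); have := cnormM_le (u - v) v.
  have := cnorm_ge0 (u - v); nra.
- move=> x Hx; split.
  + apply: (@cnorm_approx_eq _ _ 2) => // e e0; have [w [sw _ _] xw] := Hx e e0.
    have -> : star x - x = star (x - w) - (x - w).
      by rewrite !starE sw; nalg A; ring.
    apply: (le_trans (cnormB _ _)); rewrite cnorm_star; lra.
  + move=> c cy; apply: (@cnorm_approx_eq _ _ (2 * N c)).
      by rewrite mulr_ge0// cnorm_ge0.
    move=> e e0; have [w [_ cw _] xw] := Hx e e0.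
    have -> : c * x - x * c = c * (x - w) - (x - w) * c.
      by rewrite mulrBl mulrBr (cw c cy); nalg A; ring.
    apply: (le_trans (cnormB _ _)).
    have := cnormM_le c (x - w); have := cnormM_le (x - w) c.
    have := cnorm_ge0 c; nra.
  + apply: (@le_approx _ _ 1) => // e e0; have [w [_ _ Nw] xw] := Hx e e0.
    have := cnormD w (x - w); rewrite addrC subrK; lra.
exists (1 - w); split.
- by rewrite !starE sw.
- by move=> x xy; rewrite mulrBr mulrBl mulr1 mul1r (cw x xy).
have E : w + w = y + w * w.
  rewrite -[in LHS]fw /f -scalerDl -rmorphD/=.
  by rewrite (_ : 2^-1 + 2^-1 = 1 :> R) ?scale1r//; lra.
have -> : (1 - w) * (1 - w) = 1 - y + (y + w * w - (w + w)) by nalg A; ring.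
by rewrite E subrr addr0.
Qed.

Lemma csqrt_sub t y : star y = y -> N y < t ->
  exists z, [/\ star z = z, bicomm y z & z * z = r1 t - y].
Proof.
move=> sy yt; have t0 : 0 < t := le_lt_trans (cnorm_ge0 y) yt.
have [||z [sz cz z2]] := @csqrt1 ((t^-1)%:C *: y).
- by rewrite starZr sy.
- by rewrite cnormZr gtr0_norm ?invr_gt0// mulrC ltr_pdivrMr// mul1r.
exists ((Num.sqrt t)%:C *: z); split.
- by rewrite starZr sz.
- move=> x xy; rewrite -scalerAr -scalerAl cz// -scalerAr -scalerAl.
  by rewrite xy.
rewrite -scalerAl -scalerAr scalerA -rmorphM/= -expr2 sqr_sqrtr ?ltW// z2.
by rewrite scalerBr scalerA -rmorphM/= divff ?gt_eqF// scale1r.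
Qed.

End CstarInverse.

(** * Positivity and spectrum of self-adjoint elements *)

Section CstarPositive.
Variables (R : realType) (V : completeNormedModType R[i]) (A : CstarAlg V).
Local Notation C := R[i].
Local Notation N := (@cnorm R V A).
Local Notation star := (@star R V A).
Local Notation cinv := (@cinv R V A).
Local Notation r1 t := (t%:C *: (1 : calg A)).
Implicit Types (x y z h : calg A) (s t : R).

Lemma cnorm_r1 t : N (r1 t) = `|t|.
Proof. by rewrite cnormZr cnorm1 mulr1. Qed.

Lemma star_shift h t : star h = h ->
  star (h + 'i *: r1 t) * (h + 'i *: r1 t) = h * h + r1 (t * t).
Proof. by move=> sh; rewrite !starE sh; nalg A; have E := complexi2 R; ring: E. Qed.

(** The bound has no term linear in [t], whereas [(b + t)^2] contains [2 b t]; comparing the two for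
    a suitable [t] rules out a nonzero imaginary part [b]. *)
Lemma cnorm_shift h t : star h = h ->
  N (h + 'i *: r1 t) ^+ 2 <= N h ^+ 2 + t ^+ 2.
Proof.
move=> sh; rewrite -cnorm_starM star_shift//.
apply: (le_trans (cnormD _ _)); rewrite cnorm_sqr// cnorm_r1 -expr2.
by rewrite ger0_norm ?sqr_ge0.
Qed.

(* Shifting by a large imaginary multiple of the identity moves a nonreal
   scalar out of the disc that contains the spectrum. *)
Lemma selfadjoint_nonreal h (l : C) : star h = h -> complex.Im l != 0 ->
  cinv (h - l *: 1).
Proof.
(* Chosen so that [2 b n = (N h)^2]: then [|a + i (b + n)|^2] exceeds [(N h)^2 + n^2] by
   [a^2 + b^2 > 0]. *)
case: l => a b sh /= b0; pose n := N h ^+ 2 / (2 * b).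
rewrite (_ : _ - _ = - ((a +i* (b + n)) *: 1 - (h + 'i *: r1 n))); last first.
  rewrite (_ : a +i* (b + n) = a +i* b + 'i * n%:C); last by simpc.
  by nalg A; ring.
apply/cinvN/cinv_subl.
have nE : 2 * b * n = N h ^+ 2 by rewrite /n mulrC divfK// mulf_neq0.
rewrite -(@ltr_pXn2r _ 2)// ?nnegrE ?cnorm_ge0 ?Re_norm_ge0//.
rewrite sqr_Re_norm (le_lt_trans (cnorm_shift n sh))//=.
have : 0 < b ^+ 2 by rewrite lt_def sqrf_eq0 b0 sqr_ge0.
rewrite -nE; nra.
Qed.

(** Only negative real scalars [- t] are tested, because [selfadjoint_nonreal] settles the nonreal
    ones; [cposE] compares this with [cpositive]. *)
Definition cpos h : Prop := star h = h /\ forall t, 0 < t -> cinv (h + r1 t).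

Lemma cposE h : cpos h <-> cpositive A h.
Proof.
split=> [[sh Hh]|[sh Hh]]; split=> //.
  case=> a b Hl; have [b0|b0] := eqVneq b 0; last exact: selfadjoint_nonreal.
  have a0 : 0 < - a.
    rewrite oppr_gt0 ltNge; apply/negP => a0.
    by apply: Hl; rewrite b0 complexr0 ler0c.
  have := Hh _ a0; rewrite rmorphN scaleNr.
  by rewrite b0 complexr0.
move=> t t0; have := Hh (- t)%:C; rewrite rmorphN scaleNr opprK; apply.
by rewrite oppr_ge0 lecR; apply/negP; rewrite -ltNge.
Qed.

(** Factor [h^2 + t] as [(h - i sqrt t) (h + i sqrt t)] and apply [selfadjoint_nonreal] to each
    factor. *)
Lemma cinv_sqr_add h t : star h = h -> 0 < t -> cinv (h * h + r1 t).
Proof.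
move=> sh t0; pose s := Num.sqrt t.
have s2 : s * s = t by rewrite -expr2 sqr_sqrtr// ltW.
have s0 : s != 0 by rewrite gt_eqF// sqrtr_gt0.
have -> : h * h + r1 t = (h - ('i * s%:C) *: 1) * (h - (- ('i * s%:C)) *: 1).
  rewrite -s2; nalg A; have E := complexi2 R; ring: E.
apply: cinvM; apply: selfadjoint_nonreal => //=; simpc => //=.
by rewrite oppr_eq0.
Qed.

Lemma cpos_sqr h : star h = h -> cpos (h * h).
Proof.
by move=> sh; split; [rewrite starM sh|move=> t; exact: cinv_sqr_add].
Qed.

(* If [r - h] and [r + h] were both invertible with [r = N h], then
   [r^2 - e - h^2] would have a self-adjoint square root [z] commuting with
   [h]; the square norm of [h + i z] is [r^2 - e], and it bounds that of [h]. *)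
Lemma selfadjoint_norm_spectrum h : star h = h ->
  cinv (r1 (N h) - h) -> cinv (r1 (N h) + h) -> False.
Proof.
move=> sh inv1 inv2; pose r := N h.
have r0 : 0 < r.
  rewrite lt_def cnorm_ge0 andbT; apply/eqP => r0.
  have [y [+ _]] := inv1; rewrite -/r r0 (cnorm_eq0 r0) scale0r subrr mul0r.
  by move/esym/eqP; rewrite oner_eq0.
have [W [W1 W2]] : cinv (r1 (r * r) - h * h).
  rewrite (_ : _ - _ = (r1 r - h) * (r1 r + h)); first exact: cinvM.
  by nalg A; ring.
pose M := N W; have M0 : 0 <= M := cnorm_ge0 W.
have p0 : 0 <= M * (r * r) by rewrite !mulr_ge0// ltW.
have d0 : 0 < 1 + 4 * (M * (r * r)) by lra.
(* Small enough for [e <= r^2] and [e * N W <= 1/4], so that [r^2 + e - h^2] stays invertible and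
   its inverse [W'] satisfies [N (2 e W') < 1]. *)
pose e := r * r / (1 + 4 * (M * (r * r))).
have e0 : 0 < e by rewrite divr_gt0// mulr_gt0.
have er : e <= r * r by rewrite ler_pdivrMr// ler_peMr//; nra.
have eM : e * M <= 4^-1.
  rewrite mulrAC ler_pdivrMr// mulrC; lra.
have [|W' [Z1 Z2 NW']] := @cinv_perturb _ _ _ _ _ (- r1 e) W1 W2.
  by rewrite cnormN cnorm_r1 gtr0_norm// mulrC; lra.
rewrite cnormN cnorm_r1 gtr0_norm// -/M in NW'.
set X := _ - _ in Z1 Z2.
have XE : X = r1 (r * r + e) - h * h by rewrite /X; nalg A; ring.
have NW : N ((2 * e)%:C *: W') < 1.
  rewrite cnormZr gtr0_norm; last by rewrite pmulr_rgt0.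
  have := cnorm_ge0 W'; move: (N W') NW' => a H a0.
  have : a * (3/4) <= M by nra.
  by nra.
have sX : star X = X by rewrite XE !starE sh.
have sW' : star W' = W' := star_inv sX Z1 Z2.
(* Since [h^2] has norm [r^2], [csqrt_sub] does not reach [r^2 - e - h^2] directly. It gives a root
   [z] of [X = r^2 + e - h^2]; with a root [v] of [1 - 2 e W'], [(z v)^2 = X - 2 e]. *)
have [||z [sz cz z2]] := @csqrt_sub R V A (r * r + e) (h * h).
- by rewrite starM sh.
- by rewrite cnorm_sqr// expr2 ltrDl.
have [||v [sv cv v2]] := @csqrt1 R V A ((2 * e)%:C *: W').
- by rewrite starZr sW'.
- exact: NW.
have commX c : c * (h * h) = (h * h) * c -> c * v = v * c.
  move=> ch; apply: cv; rewrite -scalerAr -scalerAl.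
  congr (_ *: _); apply: (cinv_comm Z1 Z2).
  by rewrite XE mulrBl mulrBr ch -scalerAl -scalerAr mulr1 mul1r.
have zv : z * v = v * z by apply: commX; rewrite -(cz (h * h)).
have hv : h * v = v * h by apply: commX; rewrite mulrA.
have hz : h * z = z * h by apply: cz; rewrite mulrA.
have sw : star (z * v) = z * v by rewrite starM sz sv.
have hzv : h * (z * v) = z * v * h by rewrite mulrA hz -mulrA hv mulrA.
have zv2 : (z * v) * (z * v) = r1 (r * r - e) - h * h.
  rewrite {1}zv -mulrA (mulrA z) z2 -XE mulrA; rewrite -(commX X); last first.
    by rewrite XE mulrBl mulrBr -scalerAl -scalerAr mulr1 mul1r.
  rewrite -mulrA v2 mulrBr mulr1 -scalerAr Z1 XE; nalg A; ring.
move: (z * v) sw hzv zv2 => w sw hw w2.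
pose q : calg A := h + 'i *: w.
have qq : star q * q = r1 (r * r - e).
  rewrite /q !starE sh sw.
  rewrite (_ : _ * _ = h * h + w * w + 'i *: (h * w - w * h)); last first.
    by nalg A; have E := complexi2 R; ring: E.
  by rewrite hw subrr scaler0 addr0 w2 addrC subrK.
have Nq : N q ^+ 2 = r * r - e.
  by rewrite -cnorm_starM qq cnorm_r1 ger0_norm// subr_ge0.
have Nh : r <= N q.
  have := cnormD q (star q); rewrite cnorm_star.
  rewrite (_ : q + star q = 2%:C *: h); last first.
    by rewrite /q !starE sh sw; nalg A; ring.
  by rewrite cnormZr ger0_norm// -/r; lra.
have := cnorm_ge0 q; move: (N q) Nq Nh => a; nra.
Qed.

(** If [t < N h], then [N h - h] and [N h + h] are positive elements shifted by [N h - t > 0], hence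
    both invertible, against [selfadjoint_norm_spectrum]. *)
Lemma cpos_norm_le h t : star h = h -> cpos (r1 t - h) -> cpos (r1 t + h) ->
  N h <= t.
Proof.
move=> sh [_ H1] [_ H2]; rewrite leNgt; apply/negP => ht.
have d0 : 0 < N h - t by rewrite subr_gt0.
apply: (selfadjoint_norm_spectrum sh).
  by have := H1 _ d0; rewrite addrAC -scalerDl -rmorphD/= [t + _]addrC subrK.
by have := H2 _ d0; rewrite addrAC -scalerDl -rmorphD/= [t + _]addrC subrK.
Qed.

(** Together with [cpos_norm], this describes positivity by the norm alone; closure under sums then
    reduces to the triangle inequality. *)
Lemma cpos_of_norm h t : star h = h -> N (r1 t - h) <= t -> cpos h.
Proof.
move=> sh ht; split=> // s s0.
rewrite (_ : h + _ = r1 (t + s) - (r1 t - h)); last by nalg A; ring.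
by apply: cinv_sublr; rewrite (le_lt_trans ht)// ltrDl.
Qed.

Lemma cpos_norm h : cpos h -> N (r1 (N h) - h) <= N h.
Proof.
move=> [sh Hh]; apply: cpos_norm_le; first by rewrite !starE sh.
  by rewrite opprB addrC subrK; split.
apply: (@cpos_of_norm _ (N h + N h)); first by rewrite !starE sh.
rewrite (_ : _ - _ = h); last by nalg A; ring.
by rewrite lerDl cnorm_ge0.
Qed.

Lemma cposD x y : cpos x -> cpos y -> cpos (x + y).
Proof.
move=> Hx Hy; apply: (@cpos_of_norm _ (N x + N y)).
  by rewrite starD Hx.1 Hy.1.
rewrite (_ : _ - _ = (r1 (N x) - x) + (r1 (N y) - y)); last by nalg A; ring.
by apply: (le_trans (cnormD _ _)); apply: lerD; exact: cpos_norm.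
Qed.

Lemma cposZ t x : 0 < t -> cpos x -> cpos (t%:C *: x).
Proof.
move=> t0 [sx Hx]; split; first by rewrite starZr sx.
move=> s s0; rewrite (_ : _ + _ = t%:C *: (x + r1 (s / t))); last first.
  rewrite scalerDr scalerA -rmorphM/= mulrCA mulfV ?mulr1//.
  by rewrite gt_eqF.
by apply: cinvZ; [rewrite eq_complex/= eqxx andbT gt_eqF|apply: Hx; rewrite divr_gt0].
Qed.

Lemma cpos_sub_norm h t : star h = h -> N h <= t -> cpos (r1 t - h).
Proof.
move=> sh ht; apply: (@cpos_of_norm _ t); first by rewrite !starE sh.
by rewrite opprB addrC subrK.
Qed.

Lemma cpos_r1 t : 0 <= t -> cpos (r1 t).
Proof.
move=> t0; apply: (@cpos_of_norm _ t); first by rewrite !starE.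
by rewrite subrr cnorm0.
Qed.

End CstarPositive.

(** * Positivity of [x^* x] and the contraction estimate *)

Section CstarOrder.
Variables (R : realType) (V : completeNormedModType R[i]) (A : CstarAlg V).
Local Notation C := R[i].
Local Notation N := (@cnorm R V A).
Local Notation star := (@star R V A).
Local Notation cinv := (@cinv R V A).
Local Notation cpos := (@cpos R V A).
Local Notation r1 t := (t%:C *: (1 : calg A)).
Implicit Types (x y z h : calg A) (s t : R).

(** Jacobson's formula: if [g] inverts [t - x y], then [t^-1 (1 + y g x)] inverts [t - y x]. *)
Lemma cinv_swap t x y : t != 0 -> cinv (r1 t - x * y) -> cinv (r1 t - y * x).
Proof.
move=> t0 [g [g1 g2]].
have E1 : t%:C *: g = 1 + x * y * g by rewrite -g1; nalg A; ring.
have E2 : t%:C *: g = 1 + g * (x * y) by rewrite -g2; nalg A; ring.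
have t0' : t%:C != 0 by rewrite eq_complex/= eqxx andbT.
exists ((t%:C)^-1 *: (1 + y * g * x)); split.
  rewrite -scalerAr (_ : _ * _ = t%:C *: 1 - y * x + y * (t%:C *: g) * x
    - y * (x * y * g) * x); last by nalg A; ring.
  rewrite E1 (_ : _ - _ = t%:C *: 1); last by nalg A; ring.
  by rewrite scalerA mulVf// scale1r.
rewrite -scalerAl (_ : _ * _ = t%:C *: 1 - y * x + y * (t%:C *: g) * x
  - y * (g * (x * y)) * x); last by nalg A; ring.
rewrite E2 (_ : _ - _ = t%:C *: 1); last by nalg A; ring.
by rewrite scalerA mulVf// scale1r.
Qed.

(** With [x = h + i k] for self-adjoint [h] and [k], the sum is [2 (h^2 + k^2)]. *)
Lemma cpos_starM_add x : cpos (star x * x + x * star x).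
Proof.
have -> : star x * x + x * star x = (2^-1 : R)%:C *:
    ((x + star x) * (x + star x) + ('i *: (x - star x)) * ('i *: (x - star x))).
  by have E := complexi2 R; nalg A; rewrite fmorphV rmorph_nat; field: E.
apply: cposZ; first by rewrite invr_gt0.
apply: cposD; apply: cpos_sqr; rewrite !starE; first by rewrite addrC.
by rewrite -scalerN opprB.
Qed.

(* At a point [tau] just above the largest [t] with [y + t] singular, the
   resolvent [G] is large. With [c = p G], the element [c^* c = G - tau G^2] is at
   most [1 / (4 tau)], hence so is [c c^*]; positivity of [c^* c + c c^*] then
   bounds the norm of [c^* c], and so that of [G]. *)
Lemma cpos_starM p : cpos (star p * p).
Proof.
have [y yE] : exists y, y = star p * p by exists (star p * p).
have sy : star y = y by rewrite yE !starE.
rewrite -yE; split=> // t1 t1_gt0; apply: contrapT => Nt1.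
pose E : set R := [set t | ~ cinv (y + r1 t)].
have ubE : ubound E (N y).
  move=> t Et; rewrite leNgt; apply/negP => yt; apply: Et.
  have -> : y + r1 t = r1 t - (- y) by rewrite opprK addrC.
  by apply: cinv_sublr; rewrite cnormN.
have hE : has_sup E by split; [exists t1|exists (N y)].
pose t0 := sup E; have t0_gt0 : 0 < t0.
  by rewrite (lt_le_trans t1_gt0)//; apply: ub_le_sup => //; exists (N y).
(* Then [tau = 5 d] lies within [2 d] of a point of [E], which forces [tau * N G >= 5/2]; this
   contradicts the final bound [n^2 <= n + 1/4] for [n = tau * N G]. *)
pose d := t0 / 4; have d0 : 0 < d by rewrite divr_gt0.
pose tau := t0 + d; have tau0 : 0 < tau by rewrite addr_gt0.
have [G [G1 G2]] : cinv (y + r1 tau).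
  apply: contrapT => Etau; have : tau <= t0.
    by apply: ub_le_sup => //; exists (N y).
  by rewrite /tau; lra.
have [t Et tt0] := sup_adherent d0 hE; rewrite -/t0 in tt0.
have tle : t <= t0 by apply: ub_le_sup => //; exists (N y).
have NG : 1 <= N G * (tau - t).
  rewrite leNgt; apply/negP => NG; apply: Et.
  have [|g [g1 g2 _]] := @cinv_perturb R V A _ _ (r1 (tau - t)) G1 G2.
    by rewrite cnorm_r1 ger0_norm//; rewrite /tau; lra.
  exists g; rewrite (_ : y + r1 t = y + r1 tau - r1 (tau - t)) //.
  by nalg A; ring.
have sG : star G = G by apply: star_inv G1 G2; rewrite !starE sy.
have Gy : G * y = 1 - tau%:C *: G by rewrite -G2; nalg A; ring.
pose c := p * G; pose k := star c * c.
have kE : k = G - tau%:C *: (G * G).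
  rewrite /k /c starM sG mulrA -(mulrA G) -yE Gy; nalg A; ring.
pose s := (4 * tau)^-1; have s0 : 0 < s by rewrite invr_gt0 mulr_gt0.
have sk : star k = k by rewrite /k starM starK.
(* Completing the square in [k = G - tau G^2]. *)
have pos1 : cpos (r1 s - k).
  rewrite (_ : _ - _ = tau%:C *: ((G - r1 (2 * tau)^-1) * (G - r1 (2 * tau)^-1))).
    apply: cposZ => //; apply: cpos_sqr; by rewrite !starE sG.
  have tC : tau%:C != 0 by rewrite eq_complex/= eqxx andbT gt_eqF.
  rewrite kE /s; nalg A; rewrite ?fmorphV ?rmorphM ?rmorph_nat; field => //; exact: tC.
have pos2 : cpos (r1 s - c * star c).
  split; first by rewrite starB starM starZr star1 starK.
  move=> a a0; rewrite addrAC -scalerDl -rmorphD/=.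
  apply: cinv_swap; first by rewrite gt_eqF// addr_gt0.
  by rewrite rmorphD scalerDl addrAC; exact: pos1.2.
have pos3 : cpos (r1 s + k).
  rewrite (_ : _ + _ = (r1 s - c * star c) + (k + c * star c)).
    by apply: cposD => //; exact: cpos_starM_add.
  by nalg A; ring.
have Nk := cpos_norm_le sk pos1 pos3.
have H1 : tau * N G ^+ 2 <= N G + s.
  rewrite -cnorm_sqr// -[X in X * _]gtr0_norm// -cnormZr.
  rewrite (_ : _ *: _ = G - k); last by rewrite kE; nalg A; ring.
  by apply: (le_trans (cnormB _ _)); rewrite lerD2l.
have H2 : s * tau = 4^-1 by rewrite /s invfM mulfVK// gt_eqF.
have tauE : tau = 5 * d by rewrite /tau /d; lra.
have H3 : 5 / 2 <= tau * N G.
  have : N G * (tau - t) <= N G * (2 * d).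
    by apply: ler_wpM2l; [exact: cnorm_ge0|rewrite /tau; lra].
  by rewrite {2}tauE; lra.
have : (tau * N G) ^+ 2 <= tau * N G + 4^-1.
  by rewrite -H2 exprMn expr2 -mulrA [s * tau]mulrC -mulrDr ler_wpM2l// ltW.
move: (tau * N G) H3 => n H3; nra.
Qed.

(** With [z] a root of [t + e - y], [x^* (t + e - y) x] is [(z x)^* (z x)]; the excess [e x^* x] is
    absorbed by half of the shift [s]. *)
Lemma cpos_congr t y x : star y = y -> N y <= t ->
  cpos (star x * (r1 t - y) * x).
Proof.
move=> sy yt; split; first by rewrite !starE sy mulrA.
move=> s s0; pose n := N (star x * x); have n0 : 0 <= n := cnorm_ge0 _.
pose e := s / 2 / (n + 1).
have n1 : 0 < n + 1 by lra.
have e0 : 0 < e by rewrite !divr_gt0.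
have en : e * n <= s / 2 by rewrite mulrAC ler_pdivrMr//; nra.
have [|z [sz _ z2]] := @csqrt_sub R V A (t + e) y sy.
  by rewrite (le_lt_trans yt)// ltrDl.
rewrite (_ : _ + _ = star (z * x) * (z * x) + (r1 (s / 2) - e%:C *: (star x * x))
   + r1 (s / 2)).
  apply: (proj2 (cposD (cpos_starM _) _)); last by rewrite divr_gt0.
  apply: cpos_sub_norm; first by rewrite !starE.
  by rewrite cnormZr gtr0_norm.
rewrite (_ : star (z * x) * _ = star x * (z * z) * x).
  by rewrite z2 {1}[s]splitr; nalg A; ring.
by rewrite starM sz !mulrA.
Qed.

(* [[x, D^(1/2)]] is a row of norm [N x], since [x x^* + D = (N x)^2]. *)
Lemma cnorm_row x m e (D := r1 (N x ^+ 2) - x * star x) :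
  0 < N x ->
  N (x * m + D * e) ^+ 2 <= N x ^+ 2 * (N m ^+ 2 + N e * N D * N e).
Proof.
move=> x0; pose r := N x ^+ 2.
have [u uE] : exists u, u = x * m + D * e by exists (x * m + D * e).
have r0 : 0 < r by rewrite exprn_gt0.
have sD : star D = D by rewrite /D !starE.
have su : star u = star m * star x + star e * D.
  by rewrite uE starD !starM sD.
pose T := r%:C *: (star m * m + star e * D * e).
have rC : r%:C != 0 by rewrite eq_complex/= eqxx andbT gt_eqF.
(* Completing squares: [m = x^* u / r] and [e = u / r] also represent [u], because [x x^* + D = r],
   and turn [u^* u <= T] into an equality. *)
have TE : T - star u * u = r%:C *: (star (m - (r^-1)%:C *: (star x * u)) *
    (m - (r^-1)%:C *: (star x * u))
    + star (e - (r^-1)%:C *: u) * D * (e - (r^-1)%:C *: u)).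
  have H : r%:C * (r^-1)%:C = 1 by rewrite -rmorphM/= mulfV// gt_eqF.
  (* The equation [u = x m + D e] is used here; what remains is an identity with [u] a free
     variable. *)
  apply: (@eq_trans _ _ (T - (star m * star x + star e * D) * u
      - star u * (x * m + D * e) + star u * u)).
    by rewrite -su -uE; nalg A; ring.
  rewrite /T !starB !starZr !starM starK /D -/r.
  by nalg A; ring: H.
have posT : cpos (T - star u * u).
  rewrite TE; apply: cposZ => //; apply: cposD; first exact: cpos_starM.
  apply: cpos_congr; rewrite ?starE//.
  by rewrite -{1}(starK x) cnorm_starM cnorm_star.
have sT : star T = T by rewrite /T starZr starD !starM !starK sD mulrA.
rewrite -uE -cnorm_starM; apply: (@le_trans _ _ (N T)).
  apply: cpos_norm_le; first by rewrite !starE.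
    rewrite (_ : _ - _ = (r1 (N T) - T) + (T - star u * u)).
      by apply: cposD => //; exact: cpos_sub_norm.
    by nalg A; ring.
  by apply: cposD; [apply: cpos_r1; exact: cnorm_ge0|exact: cpos_starM].
rewrite cnormZr gtr0_norm// ler_pM2l//.
apply: (le_trans (cnormD _ _)); rewrite cnorm_starM lerD2l.
apply: (le_trans (cnormM_le _ _)); apply: ler_wpM2r; first exact: cnorm_ge0.
by rewrite (le_trans (cnormM_le _ _))// cnorm_star.
Qed.

Lemma orthogonal_norm1 x (B : set (calg A)) (al be : C) b :
  (forall k b, B b -> B (k *: b)) ->
  (forall b, B b -> N x <= N (x + b)) -> B b ->
  al + be * (N x ^+ 2)%:C = 1 ->
  1 <= N (al *: 1 + be *: (star x * x) + star x * b).
Proof.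
move=> BZ xB Bb ab1; set g := _ + star x * b; rewrite leNgt; apply/negP => g1.
(* If [x = 0], the constraint forces [al = 1], hence [g = 1]. *)
have [x0|x0] := eqVneq (N x) 0.
  move: g1 ab1; rewrite /g (cnorm_eq0 x0) star0 !mul0r scaler0 !addr0 cnorm0.
  by rewrite expr0n/= mulr0 addr0 => + al1; rewrite al1 scale1r cnorm1 ltxx.
have {}x0 : 0 < N x by rewrite lt_def x0 cnorm_ge0.
pose r := N x ^+ 2; have r0 : 0 < r by rewrite exprn_gt0.
pose D := r1 r - x * star x; pose e := be *: x + b.
pose K := N e * N D * N e; have K0 : 0 <= K by rewrite !mulr_ge0 ?cnorm_ge0.
pose eta := 1 - N g; have eta0 : 0 < eta by rewrite subr_gt0.
have eta1 : eta <= 1 by rewrite /eta lerBlDr lerDl cnorm_ge0.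
have d0 : 0 < 1 + K + eta ^+ 2 by have := sqr_ge0 eta; lra.
(* Gives [s <= 1] and [s (K + eta^2) < eta], whereas minimality will yield
   [2 eta <= s (K + eta^2)]. *)
pose s := eta / (1 + K + eta ^+ 2).
have s0 : 0 < s by rewrite divr_gt0.
have sd : s * (1 + K + eta ^+ 2) = eta by rewrite /s divfK// gt_eqF.
have s1 : s <= 1 by have := sqr_ge0 eta; nra.
pose m := r1 (1 - s) + s%:C *: g.
have alE : al = 1 - be * r%:C by rewrite -ab1 addrK.
have uE : x + (s * r)%:C *: b = x * m + D * (s%:C *: e).
  by rewrite /m /D /e /g alE; nalg A; ring.
have Nm : N m <= 1 - s * eta.
  rewrite (le_trans (cnormD _ _))// cnorm_r1 cnormZr ger0_norm ?subr_ge0//.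
  by rewrite gtr0_norm// /eta; lra.
have Nse : N (s%:C *: e) = s * N e by rewrite cnormZr gtr0_norm.
have /(_ m (s%:C *: e))/(_ x0) := @cnorm_row x; rewrite -/r -/D -uE Nse => H.
have := xB _ (BZ (s * r)%:C _ Bb) => H2.
have H3 : r <= r * (N m ^+ 2 + s * N e * N D * (s * N e)).
  apply: le_trans H; rewrite /r ler_pXn2r// ?nnegrE ?cnorm_ge0//.
rewrite ler_pMr// in H3.
have H4 : 1 <= N m ^+ 2 + s ^+ 2 * K.
  by apply: (le_trans H3); rewrite lerD2l /K; lra.
have H5 : N m ^+ 2 <= (1 - s * eta) ^+ 2.
  by rewrite ler_pXn2r// ?nnegrE ?cnorm_ge0// (le_trans (cnorm_ge0 m)).
have H6 : 2 * (s * eta) <= s * (s * (K + eta ^+ 2)) by lra.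
have H7 : 2 * eta <= s * (K + eta ^+ 2) by nra.
clear ab1 alE uE; lra.
Qed.

(** Homogeneity reduces to the value 1. By linearity the bound also shows that [al + be (N x)^2]
    depends only on the element, not on its representation. *)
Lemma orthogonal_norm x (B : set (calg A)) (al be : C) b :
  (forall k b, B b -> B (k *: b)) ->
  (forall b, B b -> N x <= N (x + b)) -> B b ->
  complex.Re `|al + be * (N x ^+ 2)%:C| <=
    N (al *: 1 + be *: (star x * x) + star x * b).
Proof.
move=> BZ xB Bb; set c := al + _.
have [->|c0] := eqVneq c 0; first by rewrite normr0 cnorm_ge0.
have := @orthogonal_norm1 x B (c^-1 * al) (c^-1 * be) (c^-1 *: b) BZ xB (BZ _ _ Bb).
rewrite -mulrA -mulrDr mulVf// => /(_ erefl).
rewrite -!scalerA -scalerAr -!scalerDr cnormZ.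
set n := N _ => H.
have := ler_wpM2l (Re_norm_ge0 c) H.
by rewrite mulr1 mulrA [X in X * n]mulrC Re_normV// mul1r.
Qed.

End CstarOrder.

(** * Hahn-Banach extension, real and complex *)

Section HahnBanach.
Variables (R : realType) (V : lmodType R[i]) (p : V -> R).
Hypothesis pD : forall x y, p (x + y) <= p x + p y.
Hypothesis pZ : forall t x, 0 <= t -> p (t%:C *: x) = t * p x.
Implicit Types (x y v w : V) (s t : R) (G : set (V * R)).

(** Partial functionals are encoded as graphs, so that Zorn's lemma runs over inclusion;
    single-valuedness follows from linearity and domination. *)
Definition linear_graph G :=
  forall t x y a b, G (x, a) -> G (y, b) -> G (t%:C *: x + y, t * a + b).

Definition dominated_graph G := forall x a, G (x, a) -> a <= p x.

Let good G := linear_graph G /\ dominated_graph G.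

(** Each [a - p (w - v)] is at most each [p (w' + v) - a'], so the supremum [c] of the former is an
    admissible value at [v]. *)
Lemma extend_graph G v : G (0, 0) -> good G ->
  exists G', [/\ good G', G `<=` G' & exists a, G' (v, a)].
Proof.
move=> G0 [linG domG].
have domN w w' a a' : G (w, a) -> G (w', a') -> a - p (w - v) <= p (w' + v) - a'.
  move=> Ga Ga'; rewrite lerBrDr addrAC lerBlDr.
  have := linG 1 _ _ _ _ Ga Ga'; rewrite scale1r mul1r => /domG H.
  apply: (le_trans H); have := pD (w' + v) (w - v).
  by rewrite addrACA subrr addr0 addrC.
pose L := [set a.2 - p (a.1 - v) | a in G].
pose c := sup L.
have ubL w a : G (w, a) -> c <= p (w + v) - a.
  move=> Ga; apply: ge_sup; first by exists (0 - p (0 - v)), (0, 0).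
  by move=> _ [[w' a'] Ga' <-]; exact: domN.
have lbL w a : G (w, a) -> a - p (w - v) <= c.
  move=> Ga; apply: ub_le_sup; last by exists (w, a).
  by exists (p (0 + v) - 0) => _ [[w' a'] Ga' <-]; exact: domN.
have GZ t w a : G (w, a) -> G (t%:C *: w, t * a).
  by move=> Ga; have := linG t _ _ _ _ Ga G0; rewrite !addr0.
exists [set q : V * R | exists w a t,
  G (w, a) /\ q = (w + t%:C *: v, a + t * c)]; split.
- split.
    move=> t x y a b [w [a1 [t1 [Ga [-> ->]]]]] [w' [a2 [t2 [Ga' [-> ->]]]]].
    exists (t%:C *: w + w'), (t * a1 + a2), (t * t1 + t2); split.
      exact: linG.
    congr (_, _); last by ring.
    rewrite rmorphD rmorphM/= scalerDl scalerDr scalerA.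
    by rewrite addrACA.
  move=> x a [w [a1 [t [Ga [-> ->]]]]].
  have [t0|t0|->] := ltrgtP t 0; last first.
  - by rewrite scale0r mul0r !addr0; exact: domG.
  - have := ubL _ _ (GZ t^-1 _ _ Ga); rewrite lerBrDr addrC.
    move/(ler_wpM2l (ltW t0)); rewrite mulrDr mulVKf ?gt_eqF//.
    move/le_trans; apply; rewrite -pZ; last exact: ltW.
    rewrite scalerDr scalerA -rmorphM/=.
    by rewrite mulfV ?gt_eqF// scale1r.
  - have s0 : 0 < - t by rewrite oppr_gt0.
    have := lbL _ _ (GZ (- t)^-1 _ _ Ga); rewrite lerBlDr.
    move/(ler_wpM2l (ltW s0)); rewrite mulVKf ?gt_eqF// mulrDr -lerBlDl.
    rewrite mulNr opprK => /le_trans; apply.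
    rewrite -pZ; last exact: ltW.
    rewrite scalerDr scalerA -rmorphM/=.
    by rewrite mulfV ?gt_eqF// scale1r scalerN rmorphN scaleNr opprK.
- move=> [w a] Ga; exists w, a, 0; split => //.
  by rewrite scale0r mul0r !addr0.
- exists c, 0, 0, 1; split => //.
  by rewrite scale1r mul1r !add0r.
Qed.

Lemma hahn_banach_real G0 : linear_graph G0 -> dominated_graph G0 -> G0 (0, 0) ->
  exists g : V -> R, [/\ forall t x y, g (t%:C *: x + y) = t * g x + g y,
    forall x, g x <= p x & forall x a, G0 (x, a) -> g x = a].
Proof.
move=> lin0 dom0 G00.
(* The empty chain has empty union; adjoining [G0] inside the predicate covers it and makes the
   maximal graph extend [G0]. *)
have [|G [PG maxG]] := @Zorn_bigcup _ (fun G => good (G `|` G0)).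
  move=> F FP Ftot; split.
    move=> t x y a b; pose S := \bigcup_(X in F) X.
    have step X : F X -> (X `|` G0) (x, a) -> (X `|` G0) (y, b) ->
        (S `|` G0) (t%:C *: x + y, t * a + b).
      move=> FX Xx Xy; have [/(_ t _ _ _ _ Xx Xy)[H|H] _] := FP _ FX.
        by left; exists X.
      by right.
    move=> [[X FX Xx]|Gx] [[Y FY Yy]|Gy].
    - have [XY|YX] := Ftot _ _ FX FY.
        by apply: (step Y FY); left => //; exact: XY.
      by apply: (step X FX); left => //; exact: YX.
    - by apply: (step X FX); [left|right].
    - by apply: (step Y FY); [right|left].
    - by right; exact: lin0.
  move=> x a [[X FX Xx]|]; last exact: dom0.
  by have [_] := FP _ FX; apply; left.
pose M := G `|` G0; have M0 : M (0, 0) by right.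
have MT v : exists a, M (v, a).
  have [G' [goodG' MG' [a G'a]]] := extend_graph v M0 PG.
  have G'0 : G' `|` G0 = G'.
    by apply/seteqP; split=> [q [//|Gq]|q]; [apply: MG'; right|left].
  exists a; apply: contrapT => Ma; apply: (maxG G'); last by rewrite G'0.
  split; first by move=> q Gq; apply: MG'; left.
  by move=> G'G; apply: Ma; left; exact: G'G.
have [linM domM] := PG.
(* The difference gives [(0, a - b)] in [M], and [p 0 = 0] dominates it. *)
have Mle x a b : M (x, a) -> M (x, b) -> a <= b.
  move=> Ma Mb; have := linM (-1) _ _ _ _ Mb Ma.
  rewrite rmorphN scaleN1r addNr mulN1r => /domM.
  have := @pZ 0 0 (lexx _); rewrite scale0r mul0r => ->.
  by rewrite addrC subr_le0.
have Muniq x a b : M (x, a) -> M (x, b) -> a = b.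
  by move=> Ma Mb; apply/eqP; rewrite eq_le (Mle x)// (Mle x).
pose g v := sval (cid (MT v)); have gM v : M (v, g v) := svalP (cid (MT v)).
exists g; split.
- by move=> t x y; apply: Muniq (gM _) _; apply: linM; exact: gM.
- by move=> x; exact: domM (gM x).
- by move=> x a Ga; apply: Muniq (gM x) _; right.
Qed.

End HahnBanach.

(** Extend the real part to [g] and put [f x = g x - i g (i x)]. For [w = f x], [g] takes the value
    [|w|^2] at [w^* x], which bounds the modulus of [f x]. *)
Lemma hahn_banach_complex (R : realType) (V : lmodType R[i]) (p : V -> R)
    (G : set (V * R[i])) :
  (forall x y, p (x + y) <= p x + p y) ->
  (forall (k : R[i]) x, p (k *: x) = complex.Re `|k| * p x) ->
  (forall (k : R[i]) x y a b, G (x, a) -> G (y, b) -> G (k *: x + y, k * a + b)) ->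
  (forall x a, G (x, a) -> complex.Re `|a| <= p x) -> G (0, 0) ->
  exists f : V -> R[i], [/\ forall k x y, f (k *: x + y) = k * f x + f y,
    forall x, complex.Re `|f x| <= p x & forall x a, G (x, a) -> f x = a].
Proof.
move=> pD pZ linG domG G00.
have pZr t x : 0 <= t -> p (t%:C *: x) = t * p x.
  by move=> t0; rewrite pZ Re_norm_real ger0_norm.
have ReZ (t : R) (z : R[i]) : complex.Re (t%:C * z) = t * complex.Re z.
  by case: z => a b /=; rewrite mul0r subr0.
have ReD (z w : R[i]) : complex.Re (z + w) = complex.Re z + complex.Re w.
  by case: z w => a b [].
have [|||g [ling domg gG]] := @hahn_banach_real R V p pD pZr
    [set q : V * R | exists2 a, G (q.1, a) & q.2 = complex.Re a].
- move=> t x y _ _ [a/= Ga ->] [b/= Gb ->]; exists (t%:C * a + b).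
    exact: linG.
  by rewrite /= ReD ReZ.
- by move=> x _ [a/= Ga ->]; rewrite (le_trans (Re_le_norm a))// domG.
- by exists 0.
have gD x y : g (x + y) = g x + g y.
  by have := ling 1 x y; rewrite scale1r mul1r.
have g0 : g 0 = 0 by apply: gG; exists 0.
have gZ t x : g (t%:C *: x) = t * g x by have := ling t x 0; rewrite g0 !addr0.
pose f x : R[i] := g x -i* g ('i *: x).
have fD x y : f (x + y) = f x + f y.
  by rewrite /f scalerDr !gD opprD.
have fZ k x : f (k *: x) = k * f x.
  have kE : k *: x = (complex.Re k)%:C *: x + (complex.Im k)%:C *: ('i *: x).
    by rewrite scalerA -scalerDl mulrC -complexE.
  have ikE : 'i *: (k *: x) =
      (complex.Re k)%:C *: ('i *: x) + (- complex.Im k)%:C *: x.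
    rewrite !scalerA -scalerDl; congr (_ *: _).
    by case: (k) => a b; simpc.
  rewrite /f ikE kE !gD !gZ; case: k {kE ikE} => a b /=; simpc.
  by congr (_ +i* _); ring.
exists f; split.
- by move=> k x y; rewrite fD fZ.
- move=> x; set w := f x.
  have [w0|w0] := eqVneq (complex.Re `|w|) 0.
    (* From [p 0 <= p x + p (- x)] and [p (- x) = p x]. *)
    have : 0 <= p x; last by rewrite w0.
    have := pD x (- x); rewrite subrr -scaleN1r pZ normrN normr1 /= mul1r.
    by rewrite -[in p 0](scale0r x) (pZr 0)// mul0r; lra.
  have wp : 0 < complex.Re `|w| by rewrite lt_def w0 Re_norm_ge0.
  have := domg ((w^*)%C *: x); rewrite pZ normcJ.
  have -> : g ((w^*)%C *: x) = complex.Re `|w| * complex.Re `|w|.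
    rewrite -[LHS]/(complex.Re (f ((w^*)%C *: x))) fZ -/w -[RHS]expr2.
    by rewrite sqr_Re_norm; case: (w) => a b /=; ring.
  by rewrite ler_pM2l.
- move=> x a Ga; rewrite /f (gG x (complex.Re a)); last by exists a.
  rewrite (gG ('i *: x) (complex.Re ('i * a))).
    by case: a {Ga} => a b /=; simpc.
  by exists ('i * a) => //=; have := linG 'i _ _ _ _ Ga G00; rewrite !addr0.
Qed.

(** * States, orthogonality and orthonormal bases *)

Section States.
Variables (R : realType) (V : completeNormedModType R[i]) (A : CstarAlg V).
Local Notation C := R[i].
Local Notation N := (@cnorm R V A).
Local Notation star := (@star R V A).
Local Notation cpos := (@cpos R V A).
Local Notation r1 t := (t%:C *: (1 : calg A)).
Implicit Types (x y c : calg A) (phi : calg A -> C).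

Definition clinear phi := forall k x y, phi (k *: x + y) = k * phi x + phi y.

Lemma clinear0 phi : clinear phi -> phi 0 = 0.
Proof. by move=> /(_ (-1) 0 0); rewrite scaler0 addr0 mulN1r addNr. Qed.

Lemma clinearZ phi k x : clinear phi -> phi (k *: x) = k * phi x.
Proof. by move=> lin; have := lin k x 0; rewrite (clinear0 lin) !addr0. Qed.

Lemma clinearB phi x y : clinear phi -> phi (x - y) = phi x - phi y.
Proof. by move=> lin; rewrite addrC -scaleN1r lin mulN1r addrC. Qed.

(** An imaginary part [b <> 0] is amplified by the shift [c + i t], with [t] chosen so that
    [2 b t = (N c)^2 + 1] breaks the bound of [cnorm_shift]. *)
Lemma contractive_selfadjoint_real phi c : clinear phi -> phi 1 = 1 ->
  (forall x, complex.Re `|phi x| <= N x) -> star c = c -> complex.Im (phi c) = 0.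
Proof.
move=> lin phi1 con sc; apply/eqP; apply: contrapT => /negP b0.
pose b := complex.Im (phi c); pose t := (N c ^+ 2 + 1) / (2 * b).
have tE : 2 * b * t = N c ^+ 2 + 1 by rewrite /t mulrC divfK// mulf_neq0.
have := con (c + 'i *: r1 t).
have -> : phi (c + 'i *: r1 t) = complex.Re (phi c) +i* (b + t).
  rewrite addrC scalerA lin phi1 mulr1 addrC /b.
  by case: (phi c) => a' b'; simpc.
rewrite -(@ler_pXn2r _ 2)// ?nnegrE ?cnorm_ge0 ?Re_norm_ge0//.
move=> /le_trans/(_ (cnorm_shift t sc)); rewrite sqr_Re_norm.
rewrite /=; have := sqr_ge0 (complex.Re (phi c)); have := sqr_ge0 b; nra.
Qed.

(** For positive [c], [N c - Re (phi c) <= N (N c - c) <= N c]. *)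
Lemma contractive_state phi : clinear phi -> phi 1 = 1 ->
  (forall x, complex.Re `|phi x| <= N x) -> is_state A phi.
Proof.
move=> lin phi1 con; split; first exact: lin.
split; first exact: phi1.
move=> c /cposE cc; have Imc := contractive_selfadjoint_real lin phi1 con cc.1.
rewrite lecE Imc eqxx/=.
have := le_trans (con (r1 (N c) - c)) (cpos_norm cc).
rewrite (clinearB _ _ lin) (clinearZ _ _ lin) phi1 mulr1.
move=> /(le_trans (Re_le_norm _)); case: (phi c) => a b /=; lra.
Qed.

(** The element [N c - c] is positive, so its value [N c - phi c] is nonnegative, in particular
    real. *)
Lemma state_real phi c : is_state A phi -> star c = c -> complex.Im (phi c) = 0.
Proof.
move=> [lin [phi1 pos]] sc.
have /cposE/pos : cpos (r1 (N c) - c) by exact: cpos_sub_norm.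
rewrite (clinearB _ _ lin) (clinearZ _ _ lin) [phi 1]phi1 mulr1 lecE.
by move=> /andP[/eqP + _]; case: (phi c) => a b /=; lra.
Qed.

Lemma state_star phi c : is_state A phi -> phi (star c) = (phi c)^*%C.
Proof.
move=> stphi; have [lin _] := stphi.
have /(state_real stphi) H1 : star (c + star c) = c + star c.
  by rewrite !starE addrC.
have /(state_real stphi) H2 : star ('i *: (c - star c)) = 'i *: (c - star c).
  by rewrite !starE -scalerN opprB.
rewrite (clinearZ _ _ lin) (clinearB _ _ lin) in H2.
rewrite -[c in c + _]scale1r lin mul1r in H1.
case: (phi c) (phi (star c)) H1 H2 => [a b] [a' b'] /= H1 H2.
by congr (_ +i* _); lra.
Qed.

Lemma state_starM_le phi x : is_state A phi ->
  complex.Re (phi (star x * x)) <= N x ^+ 2.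
Proof.
move=> [lin [phi1 pos]].
have sxx : star (star x * x) = star x * x by rewrite !starE.
have /cposE/pos : cpos (r1 (N x ^+ 2) - star x * x).
  by apply: cpos_sub_norm; rewrite ?cnorm_starM.
rewrite (clinearB _ _ lin) (clinearZ _ _ lin) [phi 1]phi1 mulr1 lecE.
by move=> /andP[_]; case: (phi _) => a b /=; lra.
Qed.

Lemma orthogonal_state x (B : set (calg A)) :
  (forall k b b', B b -> B b' -> B (k *: b + b')) -> B 0 ->
  (forall b, B b -> N x <= N (x + b)) ->
  exists phi : calg A -> C, [/\ is_state A phi,
    phi (star x * x) = (N x ^+ 2)%:C & forall b, B b -> phi (star x * b) = 0].
Proof.
move=> BL B0 xB.
have BZ k b : B b -> B (k *: b) by move=> Bb; rewrite -[_ *: _]addr0; exact: BL.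
(* A relation, since an element may have several representations; the three required values are read
   off at [(1, 0, 0)], [(0, 1, 0)] and [(0, 0, b)]. *)
pose G : set (calg A * C) := [set q | exists al be b, [/\ B b,
  q.1 = al *: 1 + be *: (star x * x) + star x * b & q.2 = al + be * (N x ^+ 2)%:C]].
have [||||| f [linf conf fG]] := @hahn_banach_complex R (calg A) N G.
- exact: cnormD.
- exact: cnormZ.
- move=> k _ _ _ _ [al [be [b [Bb /= -> ->]]]] [al' [be' [b' [Bb' /= -> ->]]]].
  exists (k * al + al'), (k * be + be'), (k *: b + b'); split => /=.
  + exact: BL.
  + by nalg A; ring.
  + by ring.
- by move=> _ _ [al [be [b [Bb /= -> ->]]]]; exact: (@orthogonal_norm _ _ _ _ B).
- by exists 0, 0, 0; split => //=; rewrite ?scale0r ?mulr0 ?mul0r ?addr0.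
exists f; split.
- apply: contractive_state => //; apply: fG; exists 1, 0, 0; split => //=.
    by rewrite scale1r scale0r mulr0 !addr0.
  by rewrite mul0r addr0.
- apply: fG; exists 0, 1, 0; split => //=.
    by rewrite scale1r scale0r mulr0 add0r addr0.
  by rewrite mul1r add0r.
- move=> b Bb; apply: fG; exists 0, 0, b; split => //=.
    by rewrite !scale0r !add0r.
  by rewrite mul0r addr0.
Qed.

(** Ensures that the supremum in [Mfun] is not over the empty set; a maximal orthonormal set comes
    from Zorn's lemma. *)
Lemma onb_reps_exists (phi : V -> C) (B : set V) : is_state A phi ->
  exists S, onb_reps A phi B S.
Proof.
move=> stphi.
pose P (S : set V) := [/\ S `<=` B, forall s, S s -> sip A phi s s = 1
  & forall s t, S s -> S t -> s <> t -> sip A phi s t = 0].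
have [|S [[SB S1 S0] maxS]] := @Zorn_bigcup _ P.
  move=> F FP Ftot; split.
  - by move=> s [X FX Xs]; have [+ _ _] := FP _ FX; apply.
  - by move=> s [X FX Xs]; have [_ + _] := FP _ FX; apply.
  - move=> s t [X FX Xs] [Y FY Yt].
    have [XY|YX] := Ftot _ _ FX FY.
      by have [_ _ ] := FP _ FY; apply => //; exact: XY.
    by have [_ _ ] := FP _ FX; apply => //; exact: YX.
exists S; split=> //; split=> //; split=> // b Bb b1 Sb.
apply: (maxS (S `|` [set b])).
  split; first by left.
  move=> /(_ b); move=> /(_ (or_intror erefl)) Sb'.
  have := Sb _ Sb'; rewrite b1 => /eqP; by rewrite oner_eq0.
split.
- by move=> s [/SB//|->].
- by move=> s [/S1//|->].
- move=> s t [Ss|->] [St|->] st //; first exact: S0.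
    exact: Sb.
  (* Orthogonality in the other order follows by conjugate symmetry. *)
  have := @state_star phi (star t * b) stphi; rewrite !starE.
  rewrite -[phi (star t * b)]/(sip A phi t b) Sb// conjc0.
  exact.
Qed.

End States.

(** * The squared distance as a maximum over states *)

Theorem theorem4p5 (R : realType) (V : completeNormedModType R[i])
    (A : CstarAlg V) (a : V) (B : set V) (b0 : V) :
  is_subspace B -> B b0 ->
  (forall b, B b -> `|a - b0| <= `|a - b|) ->
  (exists phi : V -> R[i], is_state A phi /\
      Mfun A a b0 B phi = ((cdist a B) ^+ 2)%:E) /\
  (forall phi : V -> R[i], is_state A phi ->
      (Mfun A a b0 B phi <= ((cdist a B) ^+ 2)%:E)%E).
Proof.
move=> [B0 BL] Bb0 best; pose x : calg A := a - b0.
have distE : cdist a B = cnorm x.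
  apply/eqP; rewrite eq_le; apply/andP; split.
    apply: ge_inf; last by exists b0.
    by exists 0 => _ [b _ <-]; exact: (cnorm_ge0 (a - b : calg A)).
  apply: lb_le_inf; first by exists (complex.Re `|a - b0|), b0.
  move=> _ [b Bb <-]; rewrite -lecR.
  have := best _ Bb; rewrite (cnormE (a - b0 : calg A)).
  by rewrite (cnormE (a - b : calg A)).
have upper phi : is_state A phi ->
    (Mfun A a b0 B phi <= ((cdist a B) ^+ 2)%:E)%E.
  move=> stphi; apply: ub_ereal_sup => _ [S _ <-].
  apply: (@le_trans _ _ (complex.Re (sip A phi (a - b0) (a - b0)))%:E).
    rewrite -[leRHS]sube0; apply: leeB => //; apply: esum_ge0 => s _.
    by rewrite lee_fin addr_ge0 ?sqr_ge0.
  by rewrite lee_fin distE; exact: (state_starM_le x stphi).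
split=> //.
have [|phi [stphi phix phiB]] := @orthogonal_state R V A x B BL B0.
  move=> b Bb; rewrite -lecR -!cnormE.
  (* Here [x + b = a - (b0 - b)] with [b0 - b] in [B]. *)
  have := best (b0 - b); rewrite opprB addrA addrAC; apply.
  by have := BL (-1) _ _ Bb Bb0; rewrite scaleN1r addrC.
exists phi; split=> //; apply/eqP; rewrite eq_le upper//=.
have [S onbS] := onb_reps_exists B stphi.
apply: ereal_sup_ubound; exists S => //.
(* Every coefficient [phi (x^* s)] vanishes, so any single basis already gives [(N x)^2]. *)
rewrite esum1; last first.
  move=> s Ss; have -> : sip A phi (a - b0) s = 0.
    by apply: phiB; have [+ _] := onbS; apply.
  by rewrite /cabs2/= expr0n/= addr0.
rewrite sube0 (_ : sip A phi (a - b0) (a - b0) = (cnorm x ^+ 2)%:C)//=.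
by rewrite distE.
Qed.
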